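(* Let $n\ge2$, let the Hamiltonian $(H_0,H_1)$ be ideal and let $\rho_d$ be a generic stationary target state ($[H_0,\rho_d]=0$) with Bloch vector $\vec s_d$. Consider the system $\dot{\vec s}=(A_0+f(\vec s)A_1)\vec s$, $f(\vec s)=\vec s_d^{\,T}A_1\vec s$, on $\mathbb{R}^{n^2-1}$. For every one of its $n!$ stationary points $\vec s^{(k)}$ corresponding to density operators isospectral with $\rho_d$, the matrix of the linearization $D_f(\vec s^{(k)})=A_0+A_1\vec s^{(k)}\,\vec s_d^{\,T}A_1$ is not symmetric; consequently the dynamics is not the gradient flow of any function.
   Context: A density operator is a positive semidefinite Hermitian $n\times n$ matrix of trace $1$; it is generic if it has $n$ distinct eigenvalues. One works in a basis in which $H_0=\mathrm{diag}(a_1,\ldots,a_n)$, $a_1\ge\cdots\ge a_n$; $H_1$ is Hermitian. With $\omega_{k\ell}=a_\ell-a_k$ and $b_{k\ell}$ the $(k,\ell)$ entry of $H_1$, the Hamiltonian is ideal if (i) for $k\ne\ell$, $p\ne q$, $\omega_{k\ell}\ne\omega_{pq}$ unless $(k,\ell)=(p,q)$; and (ii) $b_{k\ell}\ne0$ except (possibly) for $k=\ell$. Bloch representation: let $\{\xi_m\}_{m=1}^{n^2}$ be an orthonormal basis (for $\langle A,B\rangle=\mathrm{Tr}(AB)$) of the Hermitian $n\times n$ matrices with $\xi_{n^2}=\frac1{\sqrt n}I$; a density operator $\rho$ is represented by $\vec s\in\mathbb{R}^{n^2-1}$, $s_m=\mathrm{Tr}(\rho\xi_m)$. $A_j(m,m')=\mathrm{Tr}(iH_j[\xi_m,\xi_{m'}])$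 for $j=0,1$ (antisymmetric $(n^2-1)\times(n^2-1)$ matrices). The system is the Bloch form of $\dot\rho=-i[H_0+f(\rho)H_1,\rho]$, $f(\rho)=\mathrm{Tr}([-iH_1,\rho]\rho_d)$. The $n!$ stationary points are the Bloch vectors of the diagonal density operators obtained by permuting the diagonal entries of $\rho_d$. Gradient flow of a function means a system $\dot{\vec s}=\nabla F(\vec s)$ for a $C^2$ function $F$ with gradient taken in the Euclidean metric of $\mathbb{R}^{n^2-1}$. *)

(* Defs.v *)
From HB Require Import structures.
From mathcomp Require Import all_boot all_order all_algebra all_fingroup.
From mathcomp Require Import all_classical all_reals all_analysis.
From mathcomp Require Import complex.
Set Implicit Arguments.
Unset Strict Implicit.
Unset Printing Implicit Defensive.
Import Order.TTheory GRing.Theory Num.Theory numFieldNormedType.Exports.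
Local Open Scope ring_scope.
Local Open Scope complex_scope.

Section Quantum.
Variables (R : realType) (n : nat).
Implicit Types (A B H rho : 'M[R[i]]_n) (a : 'rV[R]_n).

Definition mx_commutator A B : 'M[R[i]]_n := A *m B - B *m A.

Definition psd A : Prop :=
  A \is hermsymmx /\ forall v : 'rV[R[i]]_n, 0 <= (v *m A *m map_mx Num.conj v^T) 0 0.

Definition density rho : Prop := psd rho /\ \tr rho = 1.

Definition generic rho : Prop :=
  exists l : n.-tuple R[i], uniq l /\ all (eigenvalue rho) l.

(* Same eigenvalues, counted with multiplicity. *)
Definition isospectral A B : Prop := char_poly A = char_poly B.

Definition drift a : 'M[R[i]]_n := diag_mx (map_mx (real_complex R) a).

Definition omega a (k l : 'I_n) : R := a 0 l - a 0 k.

Definition ideal a H : Prop :=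
  (forall k l p q, k != l -> p != q -> omega a k l = omega a p q ->
     (k, l) = (p, q)) /\
  (forall k l, k != l -> H k l != 0).

(* The diagonal matrix whose diagonal is that of rho, permuted by sigma. *)
Definition permuted_diag (sigma : 'S_n) rho : 'M[R[i]]_n :=
  diag_mx (\row_i rho (sigma i) (sigma i)).

Implicit Type xi : 'I_(n ^ 2) -> 'M[R[i]]_n.

(* An orthonormal basis, over the reals, of the Hermitian matrices; indices
   start at 0, so the last element, 1 / sqrt n times the identity, has index
   n ^ 2 - 1. *)
Definition bloch_basis xi : Prop :=
  [/\ forall m, xi m \is hermsymmx,
      forall m m', \tr (xi m *m xi m') = (m == m')%:R,
      forall A, A \is hermsymmx ->
        exists c : 'I_(n ^ 2) -> R, A = \sum_m (c m)%:C *: xi m &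
      forall m : 'I_(n ^ 2), m = (n ^ 2 - 1)%N :> nat ->
        xi m = ((Num.sqrt (n%:R : R))^-1)%:C%:M].

Definition bloch_index (m : 'I_(n ^ 2 - 1)) : 'I_(n ^ 2) :=
  widen_ord (leq_subr 1 (n ^ 2)) m.

(* The traces in the next two definitions are real when the matrices are
   Hermitian, so taking the real part only changes the type. *)
Definition bloch xi rho : 'cV[R]_(n ^ 2 - 1) :=
  \col_m complex.Re (\tr (rho *m xi (bloch_index m))).

Definition bloch_mx xi H : 'M[R]_(n ^ 2 - 1) :=
  \matrix_(m, m') complex.Re
    (\tr ('i%C *: (H *m mx_commutator (xi (bloch_index m)) (xi (bloch_index m'))))).

End Quantum.

Section Dynamics.
Variables (R : realType) (N : nat).
Implicit Types (A : 'M[R]_N) (s sd : 'cV[R]_N).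

Definition feedback A1 sd s : R := (sd^T *m A1 *m s) 0 0.

Definition bloch_field A0 A1 sd s : 'cV[R]_N :=
  (A0 + feedback A1 sd s *: A1) *m s.

Definition linearization A0 A1 sd s : 'M[R]_N :=
  A0 + A1 *m s *m sd^T *m A1.

Implicit Type F : 'cV[R]_N -> R.

Definition partial (i : 'I_N) F : 'cV[R]_N -> R :=
  fun s => 'D_(delta_mx i 0) F s.

Definition C1 F : Prop := forall i : 'I_N,
  (forall s, derivable F s (delta_mx i 0)) /\ continuous (partial i F).

Definition C2 F : Prop := C1 F /\ forall i : 'I_N, C1 (partial i F).

(* For the Euclidean metric, the gradient is the vector of the partial
   derivatives along the standard basis. *)
Definition gradient F s : 'cV[R]_N := \col_i partial i F s.

Definition gradient_flow (V : 'cV[R]_N -> 'cV[R]_N) : Prop :=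
  exists F, C2 F /\ forall s, V s = gradient F s.

End Dynamics.

(* The Bloch vectors of density operators isospectral with rho_d at which the
   vector field V vanishes. *)
Definition isospectral_stationary (R : realType) (n : nat)
    (xi : 'I_(n ^ 2) -> 'M[R[i]]_n) (rho_d : 'M[R[i]]_n)
    (V : 'cV[R]_(n ^ 2 - 1) -> 'cV[R]_(n ^ 2 - 1))
    (s : 'cV[R]_(n ^ 2 - 1)) : Prop :=
  (exists rho, [/\ density rho, isospectral rho rho_d & s = bloch xi rho]) /\
  V s = 0.

(* Main.v *)
Require Import Defs.
From HB Require Import structures.
From mathcomp Require Import all_boot all_order all_algebra all_fingroup.
From mathcomp Require Import all_classical all_reals all_analysis.
From mathcomp Require Import complex ring lra.
Import Order.TTheory GRing.Theory Num.Theory numFieldNormedType.Exports.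
Set Implicit Arguments.
Unset Strict Implicit.
Unset Printing Implicit Defensive.
Local Open Scope ring_scope.
Local Open Scope complex_scope.
Local Open Scope sesquilinear_scope.

(** In the Bloch picture A_j acts as X |-> -i[H_j, X]. A zero of the field at
    rho satisfies [H_0 + f H_1, rho] = 0; pairing -i times this commutator with
    rho_d, which commutes with H_0, gives f^2 = 0. So f = 0 and [H_0, rho] = 0,
    and rho is diagonal because the a_k are distinct. At such a point f vanishes,
    hence the linearization is A_0 plus a rank-one matrix. On the plane spanned by
    the off-diagonal Hermitian matrices supported at (k, l) and (l, k) the
    rank-one part is symmetric, while A_0 is antisymmetric and nonzero there. The
    Jacobian of a differentiable gradient is symmetric, so the field is not a
    gradient. *)

(** * Trace identities for the generator [-i[H, X]] on Hermitian matrices *)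

Section LieMatrices.
Variables (R : realType) (n : nat).
Implicit Types (A B H X Y : 'M[R[i]]_n).

Lemma hermsymmxP A : reflect (A^t* = A) (A \is hermsymmx).
Proof.
by apply: (iffP (is_hermitianmxP _ _ _)); rewrite expr0 scale1r => /esym.
Qed.

Lemma conj_i : Num.conj ('i%C : R[i]) = - 'i%C.
Proof. by apply/eqP; rewrite eq_complex /= oppr0 !eqxx. Qed.

Lemma conj_realC (x : R) : Num.conj (x%:C) = x%:C.
Proof. by apply/conj_Creal/complex_realP; exists x. Qed.

Lemma conjtr_mulmx A B : (A *m B)^t* = B^t* *m A^t*.
Proof. by rewrite trmx_mul map_mxM. Qed.

(** The factor [-i] compensates for the commutator of two Hermitian matrices being
    skew-Hermitian. *)
Definition lie H X : 'M[R[i]]_n := - 'i%C *: mx_commutator H X.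

Lemma lie_herm H X : H \is hermsymmx -> X \is hermsymmx -> lie H X \is hermsymmx.
Proof.
move=> /hermsymmxP hH /hermsymmxP hX; apply/hermsymmxP.
rewrite /lie /mx_commutator linearZ /= map_mxZ rmorphN /= conj_i opprK.
rewrite raddfB map_mxB !conjtr_mulmx hH hX.
by rewrite scaleNr -scalerN opprB.
Qed.

Lemma tr_commutator A B : \tr (mx_commutator A B) = 0.
Proof. by rewrite /mx_commutator raddfB /= mxtrace_mulC subrr. Qed.

Lemma tr_lie H X : \tr (lie H X) = 0.
Proof. by rewrite /lie mxtraceZ tr_commutator mulr0. Qed.

Lemma tr_mul_commutator A B C :
  \tr (A *m mx_commutator B C) = \tr (B *m mx_commutator C A).
Proof.
rewrite /mx_commutator !mulmxBr !raddfB /= !mulmxA.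
rewrite -[A *m B *m C]mulmxA [\tr (A *m _)]mxtrace_mulC.
by rewrite [\tr (A *m C *m B)]mxtrace_mulC !mulmxA.
Qed.

Lemma tr_conjtr A : \tr (A^t*) = Num.conj (\tr A).
Proof. by rewrite trace_map_mx mxtrace_tr. Qed.

Lemma tr_mulmx_real X Y : X \is hermsymmx -> Y \is hermsymmx ->
  \tr (X *m Y) \is Num.real.
Proof.
move=> /hermsymmxP hX /hermsymmxP hY; apply/CrealP.
by rewrite -tr_conjtr conjtr_mulmx hX hY mxtrace_mulC.
Qed.

Lemma lieDl H K X : lie (H + K) X = lie H X + lie K X.
Proof.
by rewrite /lie /mx_commutator mulmxDl mulmxDr opprD addrACA scalerDr.
Qed.

Lemma lieZl c H X : lie (c *: H) X = c *: lie H X.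
Proof.
by rewrite /lie /mx_commutator -scalemxAl -scalemxAr -scalerBr !scalerA mulrC.
Qed.

Lemma lie_eq0 H X : lie H X = 0 -> mx_commutator H X = 0.
Proof.
move=> /(congr1 ( *:%R 'i%C)); rewrite scaler0 scalerA mulrN -expr2 sqr_i opprK.
by rewrite scale1r.
Qed.

Lemma lieC X Y : lie X Y = - lie Y X.
Proof. by rewrite /lie /mx_commutator -scalerN opprB. Qed.

(** Cyclic invariance of the trace. It lets one choose which two of the three matrices are
    bracketed, so that a commuting pair makes the trace vanish. *)
Lemma tr_mul_lieC A H X : \tr (A *m lie H X) = \tr (H *m lie X A).
Proof.
rewrite /lie -!scalemxAr !mxtraceZ; congr (_ * _); exact: tr_mul_commutator.
Qed.

Lemma lie_commutator0 H X : mx_commutator H X = 0 -> lie H X = 0.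
Proof. by rewrite /lie => ->; rewrite scaler0. Qed.

Lemma hermsymmxD X Y :
  X \is hermsymmx -> Y \is hermsymmx -> X + Y \is hermsymmx.
Proof.
by move=> /hermsymmxP hX /hermsymmxP hY; apply/hermsymmxP;
   rewrite raddfD map_mxD hX hY.
Qed.

Lemma hermsymmxZ (c : R) X : X \is hermsymmx -> c%:C *: X \is hermsymmx.
Proof.
by move=> /hermsymmxP hX; apply/hermsymmxP;
   rewrite linearZ map_mxZ hX; congr (_ *: _); apply: conj_realC.
Qed.

Lemma hermsymmx0 : (0 : 'M[R[i]]_n) \is hermsymmx.
Proof. by apply/hermsymmxP; rewrite trmx0 map_mx0. Qed.

Lemma tr_mul_lie A H X : \tr (A *m lie H X) = - 'i%C * \tr (H *m mx_commutator X A).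
Proof.
rewrite /lie -scalemxAr mxtraceZ; congr (_ * _); exact: tr_mul_commutator.
Qed.

(** With [A], [X] basis elements, this identifies [bloch_mx xi H] as the matrix of [lie H] in the
    basis [xi]. *)
Lemma tr_i_commutator A H X :
  \tr ('i%C *: (H *m mx_commutator A X)) = \tr (lie H X *m A).
Proof.
rewrite mxtraceZ [RHS]mxtrace_mulC tr_mul_lie.
by rewrite -[mx_commutator A X]opprB mulmxN raddfN /= mulrN mulNr.
Qed.

Lemma drift_herm (a : 'rV[R]_n) : drift a \is hermsymmx.
Proof.
apply/hermsymmxP/matrixP => i j; rewrite !mxE rmorphMn /= conj_realC eq_sym.
by case: eqP => [->|].
Qed.

(** * Dictionary between Hermitian matrices and Bloch vectors *)

Section Bloch.
Variables (xi : 'I_(n ^ 2) -> 'M[R[i]]_n) (hxi : bloch_basis xi) (n_gt0 : (0 < n)%N).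

Let xi_herm m : xi m \is hermsymmx. Proof. by case: hxi. Qed.

Lemma bloch_real X m : X \is hermsymmx ->
  (bloch xi X m 0)%:C = \tr (X *m xi (bloch_index m)).
Proof. by move=> hX; rewrite mxE RRe_real ?tr_mulmx_real. Qed.

(** The Bloch vector forgets the coordinate along the identity; the scalar [c] stands for it. *)
Lemma bloch_expansion X : X \is hermsymmx ->
  exists c, X = \sum_m (bloch xi X m 0)%:C *: xi (bloch_index m) + c%:M.
Proof.
move=> hX; case: hxi => _ orth /(_ X hX) [c Xc] xi_last.
have c_tr m : (c m)%:C = \tr (X *m xi m).
  rewrite Xc mulmx_suml raddf_sum /= (bigD1 m) //= -scalemxAl mxtraceZ orth.
  rewrite eqxx mulr1 big1 ?addr0 // => m' ne_m'.
  by rewrite -scalemxAl mxtraceZ orth (negPf ne_m') mulr0.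
have lt_last : (n ^ 2 - 1 < n ^ 2)%N by rewrite subn1 ltn_predL expn_gt0 n_gt0.
(* The last index is the only one outside the range of [bloch_index]; [n > 0] keeps the truncated
   [n ^ 2 - 1] below [n ^ 2]. *)
have not_last (m : 'I_(n ^ 2)) : (~~ (m < n ^ 2 - 1)%N) = (m == Ordinal lt_last).
  rewrite -leqNgt -val_eqE /= eqn_leq; case: leqP => // _; last by rewrite andbF.
  by rewrite andbT subn1 -ltnS prednK ?ltn_ord // expn_gt0 n_gt0.
exists ((c (Ordinal lt_last))%:C * ((Num.sqrt (n%:R : R))^-1)%:C).
rewrite {1}Xc (bigID (fun m : 'I_(n ^ 2) => (m < n ^ 2 - 1)%N)) /=.
rewrite (big_ord_narrow (leq_subr 1 (n ^ 2))); congr (_ + _).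
  by apply: eq_bigr => m _; rewrite bloch_real // c_tr.
rewrite (eq_bigl (pred1 (Ordinal lt_last))) // big_pred1_eq xi_last //.
by rewrite scale_scalar_mx.
Qed.

(** The identity component of [X] contributes a multiple of [\tr Y], so one traceless factor
    suffices. *)
Lemma bloch_dot X Y : X \is hermsymmx -> Y \is hermsymmx -> \tr Y = 0 ->
  (((bloch xi X)^T *m bloch xi Y) 0 0)%:C = \tr (X *m Y).
Proof.
move=> hX hY trY; have [c Xc] := bloch_expansion hX.
rewrite {2}Xc mulmxDl mulmx_suml raddfD raddf_sum /= mul_scalar_mx.
rewrite mxtraceZ trY mulr0 addr0 mxE rmorph_sum; apply: eq_bigr => m _.
by rewrite rmorphM /= mxE -scalemxAl mxtraceZ mxtrace_mulC -bloch_real.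
Qed.

(** Equal Bloch vectors leave a scalar difference, which the equal traces force to be zero. *)
Lemma bloch_inj X Y : X \is hermsymmx -> Y \is hermsymmx -> \tr X = \tr Y ->
  bloch xi X = bloch xi Y -> X = Y.
Proof.
move=> hX hY eq_tr eq_bloch.
have [c Xc] := bloch_expansion hX; have [d Yd] := bloch_expansion hY.
have eqXY : X - Y = (c - d)%:M.
  by rewrite {1}Xc {1}Yd eq_bloch opprD addrACA subrr add0r raddfB.
have /eqP : \tr (X - Y) = 0 by rewrite raddfB /= eq_tr subrr.
rewrite eqXY mxtrace_scalar mulrn_eq0 eqn0Ngt n_gt0 /= => /eqP cd0.
by apply/subr0_eq; rewrite eqXY cd0 raddf0.
Qed.

(** The identity component missing from the Bloch vector commutes with everything, so no information
    about [lie H X] is lost. *)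
Lemma bloch_mx_lie H X : H \is hermsymmx -> X \is hermsymmx ->
  bloch_mx xi H *m bloch xi X = bloch xi (lie H X).
Proof.
move=> hH hX; have [c Xc] := bloch_expansion hX.
apply/matrixP => m j; rewrite ord1; apply: complexI.
rewrite bloch_real ?lie_herm // mxE rmorph_sum /=.
set xm := xi (bloch_index m).
rewrite -tr_i_commutator.
have -> : mx_commutator xm X =
    \sum_m' (bloch xi X m' 0)%:C *: mx_commutator xm (xi (bloch_index m')).
  rewrite {1}Xc /mx_commutator mulmxDr mulmxDl scalar_mxC opprD addrACA subrr.
  rewrite addr0 mulmx_sumr mulmx_suml -sumrB; apply: eq_bigr => m' _.
  by rewrite -scalemxAr -scalemxAl scalerBr.
rewrite mulmx_sumr scaler_sumr raddf_sum; apply: eq_bigr => m' _ /=.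
rewrite rmorphM /= mxE RRe_real; last first.
  by rewrite tr_i_commutator tr_mulmx_real ?lie_herm.
by rewrite -scalemxAr !mxtraceZ mulrC mulrCA.
Qed.

Lemma bloch0 : bloch xi 0 = 0.
Proof. by apply/matrixP => m j; rewrite !mxE mul0mx raddf0. Qed.

Lemma blochDZ X Y (c : R) : X \is hermsymmx -> Y \is hermsymmx ->
  bloch xi (X + c%:C *: Y) = bloch xi X + c *: bloch xi Y.
Proof.
move=> hX hY; apply/matrixP => m j; rewrite ord1; apply: complexI.
rewrite bloch_real ?hermsymmxD ?hermsymmxZ // mulmxDl -scalemxAl raddfD /=.
rewrite mxtraceZ -!bloch_real // -rmorphM -rmorphD [in RHS]mxE.
by rewrite [X in _ = (_ + X)%:C]mxE.
Qed.

Lemma feedback_bloch H X Y :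
  H \is hermsymmx -> X \is hermsymmx -> Y \is hermsymmx ->
  (feedback (bloch_mx xi H) (bloch xi X) (bloch xi Y))%:C = \tr (X *m lie H Y).
Proof.
by move=> hH hX hY; rewrite /feedback -mulmxA bloch_mx_lie // bloch_dot
   ?lie_herm ?tr_lie.
Qed.

Lemma bloch_field_lie H0 H1 X Y :
  H0 \is hermsymmx -> H1 \is hermsymmx -> X \is hermsymmx -> Y \is hermsymmx ->
  let f := feedback (bloch_mx xi H1) (bloch xi X) (bloch xi Y) in
  bloch_field (bloch_mx xi H0) (bloch_mx xi H1) (bloch xi X) (bloch xi Y) =
  bloch xi (lie (H0 + f%:C *: H1) Y).
Proof.
move=> hH0 hH1 hX hY f; rewrite /bloch_field -/f mulmxDl -scalemxAl.
by rewrite !bloch_mx_lie // lieDl lieZl blochDZ ?lie_herm.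
Qed.

Lemma bloch_field_eq0 H0 H1 X Y :
  H0 \is hermsymmx -> H1 \is hermsymmx -> X \is hermsymmx -> Y \is hermsymmx ->
  mx_commutator H0 X = 0 ->
  bloch_field (bloch_mx xi H0) (bloch_mx xi H1) (bloch xi X) (bloch xi Y) = 0 <->
  mx_commutator H0 Y = 0 /\ \tr (X *m lie H1 Y) = 0.
Proof.
move=> hH0 hH1 hX hY H0X; rewrite bloch_field_lie //; set f := feedback _ _ _.
have f_tr : f%:C = \tr (X *m lie H1 Y) by apply: feedback_bloch.
split=> [|[H0Y trf]]; last first.
  by rewrite f_tr trf scale0r addr0 (lie_commutator0 H0Y) bloch0.
rewrite -bloch0 => /bloch_inj.
rewrite tr_lie raddf0 lie_herm ?hermsymmxD ?hermsymmxZ ?hermsymmx0 //.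
move=> /(_ isT isT erefl) lieK0.
have f0 : f = 0.
  have : \tr (X *m lie (H0 + f%:C *: H1) Y) = 0 by rewrite lieK0 mulmx0 raddf0.
  rewrite lieDl lieZl mulmxDr raddfD /= -(scalemxAr f%:C) mxtraceZ -f_tr.
  (* Two cyclic shifts turn the drift term into a trace against [lie X H0], which is zero; what
     remains is [f * f = 0]. *)
  rewrite 2!tr_mul_lieC lieC (lie_commutator0 H0X) oppr0 mulmx0 raddf0 add0r.
  by rewrite -rmorphM => /complexI/eqP; rewrite mulf_eq0 orbb => /eqP.
split; last by rewrite -f_tr f0.
by apply: lie_eq0; rewrite -lieK0 f0 scale0r addr0.
Qed.

End Bloch.

(** * Spectra of diagonal matrices and permutations of the diagonal *)

Lemma char_poly_diag (d : 'rV[R[i]]_n) :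
  char_poly (diag_mx d) = \prod_(x <- [seq d 0 i | i <- enum 'I_n]) ('X - x%:P).
Proof.
rewrite char_poly_trig ?diag_mx_is_trig // big_map big_enum.
by apply: eq_bigr => i _; rewrite mxE eqxx mulr1n.
Qed.

(** The [n] distinct eigenvalues all occur among the [n] diagonal entries, which leaves no room for
    a repetition. *)
Lemma generic_diag_inj (d : 'rV[R[i]]_n) : generic (diag_mx d) -> injective (d 0).
Proof.
move=> [l [l_uniq /allP l_eig]].
have sub : {subset l <= [seq d 0 i | i <- enum 'I_n]}.
  move=> x /l_eig; rewrite eigenvalue_root_char char_poly_diag.
  by rewrite root_prod_XsubC.
have := leq_size_uniq l_uniq sub.
rewrite size_map size_enum_ord size_tuple leqnn => /(_ isT) d_uniq.
exact/injectiveP.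
Qed.

(** Both characteristic polynomials split, and unique factorization determines the roots up to
    order. *)
Lemma isospectral_diag (d e : 'rV[R[i]]_n) :
  isospectral (diag_mx e) (diag_mx d) ->
  exists sigma : 'S_n, e = \row_i d 0 (sigma i).
Proof.
rewrite /isospectral !char_poly_diag => /prod_XsubC_eq.
move=> /(@tuple_permP _ _ (mktuple (e 0)) (mktuple (d 0))).
move=> [sigma ed]; exists sigma; apply/rowP => i.
by rewrite mxE -(tnth_mktuple (e 0)) (tnth_nth 0) ed -tnth_nth !tnth_mktuple.
Qed.

Lemma isospectral_permuted (d : 'rV[R[i]]_n) (sigma : 'S_n) :
  isospectral (diag_mx (\row_i d 0 (sigma i))) (diag_mx d).
Proof.
rewrite /isospectral !char_poly_trig ?diag_mx_is_trig //.
rewrite [RHS](reindex_inj (@perm_inj _ sigma)).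
by apply: eq_bigr => i _; rewrite !mxE !eqxx.
Qed.

Lemma psd_diag (d : 'rV[R[i]]_n) : psd (diag_mx d) <-> forall i, 0 <= d 0 i.
Proof.
split=> [[_ d_ge0] i|d_ge0].
  have := d_ge0 (delta_mx 0 i); rewrite trmx_delta map_delta_mx.
  rewrite -rowE mxE (bigD1 i) //= big1 ?addr0 => [|j /negPf ji].
    by rewrite !mxE !eqxx mulr1 mulr1n.
  by rewrite !mxE ji mulr0.
split=> [|v].
  apply/hermsymmxP; rewrite tr_diag_mx map_diag_mx; congr diag_mx.
  by apply/rowP => i; rewrite mxE; apply/conj_Creal/ger0_real.
rewrite mul_mx_diag mxE; apply: sumr_ge0 => i _; rewrite !mxE.
by rewrite mulrAC mulr_ge0 // mul_conjC_ge0.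
Qed.

Lemma density_permuted (d : 'rV[R[i]]_n) (sigma : 'S_n) :
  density (diag_mx d) -> density (diag_mx (\row_i d 0 (sigma i))).
Proof.
move=> [/psd_diag d_ge0 trd]; split; first by apply/psd_diag => i; rewrite mxE.
rewrite -trd !mxtrace_diag [RHS](reindex_inj (@perm_inj _ sigma)).
by apply: eq_bigr => i _; rewrite mxE.
Qed.

Lemma commutator_diag (d : 'rV[R[i]]_n) X i j :
  mx_commutator (diag_mx d) X i j = (d 0 i - d 0 j) * X i j.
Proof.
by rewrite /mx_commutator mul_mx_diag mul_diag_mx !mxE mulrBl [X i j * _]mulrC.
Qed.

(** If [a 0 k = a 0 l], the frequencies of [(k, l)] and [(l, k)] are both zero, hence equal. *)
Lemma ideal_inj (a : 'rV[R]_n) H : ideal a H -> injective (a 0).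
Proof.
move=> [omega_inj _] k l akl; apply/eqP; apply: contraTT isT => ne_kl.
have [] : (k, l) = (l, k).
  by apply: omega_inj => //; [rewrite eq_sym | rewrite /omega akl].
by move=> kl; rewrite kl eqxx in ne_kl.
Qed.

Lemma commutator_drift_diag (a : 'rV[R]_n) X : injective (a 0) ->
  mx_commutator (drift a) X = 0 -> X = diag_mx (\row_i X i i).
Proof.
move=> a_inj comm0; apply/matrixP => i j; rewrite !mxE.
case: eqVneq => [->//|ne_ij].
have /matrixP/(_ i j)/eqP := comm0; rewrite commutator_diag !mxE mulf_eq0.
rewrite subr_eq0 => /orP[/eqP/complexI/a_inj ij|/eqP->//].
by rewrite ij eqxx in ne_ij.
Qed.

End LieMatrices.

(** * The linearization on an off-diagonal plane *)

Section Nonsymmetry.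
Variables (R : realType) (n : nat).
Implicit Types (H X : 'M[R[i]]_n).

(** For [k != l], these two are, up to sign, the Pauli matrices x and y on the levels [k], [l]. They
    are left unnormalized, with squared norm 2. *)
Definition offdiag_re (k l : 'I_n) : 'M[R[i]]_n := delta_mx k l + delta_mx l k.
Definition offdiag_im (k l : 'I_n) : 'M[R[i]]_n :=
  'i%C *: (delta_mx k l - delta_mx l k).

Lemma offdiag_re_herm k l : offdiag_re k l \is hermsymmx.
Proof.
apply/hermsymmxP.
by rewrite raddfD map_mxD /= !trmx_delta !map_delta_mx addrC.
Qed.

Lemma offdiag_im_herm k l : offdiag_im k l \is hermsymmx.
Proof.
apply/hermsymmxP; rewrite linearZ /= map_mxZ raddfB map_mxB /= conj_i.
by rewrite !trmx_delta !map_delta_mx scaleNr -scalerN opprB.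
Qed.

Lemma commutator_diag_delta (d : 'rV[R[i]]_n) k l :
  mx_commutator (diag_mx d) (delta_mx k l) = (d 0 k - d 0 l) *: delta_mx k l.
Proof.
apply/matrixP => i j; rewrite commutator_diag !mxE.
by case: eqP => [->|_]; case: eqP => [->|_]; rewrite ?mulr0.
Qed.

Lemma commutatorDr H X Y :
  mx_commutator H (X + Y) = mx_commutator H X + mx_commutator H Y.
Proof. by rewrite /mx_commutator mulmxDr mulmxDl opprD addrACA. Qed.

Lemma commutatorZr H c X : mx_commutator H (c *: X) = c *: mx_commutator H X.
Proof. by rewrite /mx_commutator -scalemxAr -scalemxAl scalerBr. Qed.

(** [E_kl] and [E_lk] are eigenvectors of the commutator with a diagonal matrix, for opposite
    eigenvalues; hence their sum is sent to a multiple of their difference. *)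
Lemma lie_diag_offdiag_re (d : 'rV[R[i]]_n) k l :
  lie (diag_mx d) (offdiag_re k l) = (d 0 l - d 0 k) *: offdiag_im k l.
Proof.
rewrite /lie commutatorDr !commutator_diag_delta.
by apply/matrixP => i j; rewrite !mxE; ring.
Qed.

Lemma lie_diag_offdiag_im (d : 'rV[R[i]]_n) k l :
  lie (diag_mx d) (offdiag_im k l) = (d 0 k - d 0 l) *: offdiag_re k l.
Proof.
rewrite /lie commutatorZr scalerA mulNr -expr2 sqr_i opprK scale1r.
rewrite -scaleN1r commutatorDr commutatorZr !commutator_diag_delta.
by apply/matrixP => i j; rewrite !mxE; ring.
Qed.

Lemma tr_mul_lie_diag_re A (d : 'rV[R[i]]_n) k l :
  \tr (A *m lie (diag_mx d) (offdiag_re k l)) =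
  (d 0 l - d 0 k) * \tr (A *m offdiag_im k l).
Proof. by rewrite lie_diag_offdiag_re -scalemxAr mxtraceZ. Qed.

Lemma tr_mul_lie_diag_im A (d : 'rV[R[i]]_n) k l :
  \tr (A *m lie (diag_mx d) (offdiag_im k l)) =
  (d 0 k - d 0 l) * \tr (A *m offdiag_re k l).
Proof. by rewrite lie_diag_offdiag_im -scalemxAr mxtraceZ. Qed.

Lemma mxtrace_delta (k l : 'I_n) : \tr (delta_mx k l : 'M[R[i]]_n) = (k == l)%:R.
Proof.
rewrite /mxtrace (bigD1 k) //= mxE eqxx big1 ?addr0 => [|i /negPf ik].
  by rewrite eq_sym.
by rewrite mxE ik.
Qed.

Lemma tr_offdiag_re_sqr k l : k != l ->
  \tr (offdiag_re k l *m offdiag_re k l) = 2.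
Proof.
move=> /negPf kl; rewrite mulmxDl !mulmxDr !mul_delta_mx_cond !eqxx.
rewrite [l == k]eq_sym kl !mulr0n !mulr1n add0r addr0 raddfD /=.
by rewrite !mxtrace_delta !eqxx.
Qed.

Lemma tr_offdiag_im_sqr k l : k != l ->
  \tr (offdiag_im k l *m offdiag_im k l) = 2.
Proof.
move=> /negPf kl; rewrite /offdiag_im -scalemxAr -scalemxAl scalerA -expr2 sqr_i.
rewrite mulmxBl !mulmxBr !mul_delta_mx_cond !eqxx [l == k]eq_sym kl.
rewrite !mulr0n !mulr1n sub0r subr0 -opprD scaleN1r opprK raddfD /=.
by rewrite !mxtrace_delta !eqxx.
Qed.

Variables (xi : 'I_(n ^ 2) -> 'M[R[i]]_n) (hxi : bloch_basis xi) (n_gt0 : (0 < n)%N).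

(** The bilinear form of the linearization at [P] with target [Q]: the rank-one part factors through
    1 by 1 matrices into a product of two traces. *)
Lemma linearization_bloch H0 H1 P Q X Y :
  H0 \is hermsymmx -> H1 \is hermsymmx -> P \is hermsymmx -> Q \is hermsymmx ->
  X \is hermsymmx -> Y \is hermsymmx ->
  (((bloch xi X)^T *m linearization (bloch_mx xi H0) (bloch_mx xi H1)
      (bloch xi Q) (bloch xi P) *m bloch xi Y) 0 0)%:C =
  \tr (X *m lie H0 Y) + \tr (X *m lie H1 P) * \tr (Q *m lie H1 Y).
Proof.
move=> hH0 hH1 hP hQ hX hY.
have -> : (bloch xi X)^T *m linearization (bloch_mx xi H0) (bloch_mx xi H1)
      (bloch xi Q) (bloch xi P) *m bloch xi Y =
    (bloch xi X)^T *m (bloch_mx xi H0 *m bloch xi Y) +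
    ((bloch xi X)^T *m (bloch_mx xi H1 *m bloch xi P)) *m
    ((bloch xi Q)^T *m (bloch_mx xi H1 *m bloch xi Y)).
  by rewrite /linearization mulmxDr mulmxDl !mulmxA.
have mx11 (A B C : 'M[R]_1) :
    ((A + B *m C) 0 0)%:C = (A 0 0)%:C + (B 0 0)%:C * (C 0 0)%:C.
  by rewrite mxE [in LHS]mxE big_ord1 rmorphD rmorphM.
have dot Z W T : Z \is hermsymmx -> W \is hermsymmx -> T \is hermsymmx ->
    \tr (Z *m lie W T) =
    (((bloch xi Z)^T *m (bloch_mx xi W *m bloch xi T)) 0 0)%:C.
  move=> hZ hW hT; rewrite (bloch_mx_lie hxi n_gt0 hW hT).
  exact/esym/(bloch_dot hxi n_gt0 hZ (lie_herm hW hT) (tr_lie _ _)).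
apply: etrans (mx11 _ _ _) (esym _).
exact: (congr2 +%R (dot _ _ _ hX hH0 hY)
          (congr2 *%R (dot _ _ _ hX hH1 hP) (dot _ _ _ hQ hH1 hY))).
Qed.

(* X = E_kl + E_lk and Y = i (E_kl - E_lk) span a plane which every diagonal
   matrix D rotates under ad(-iD), at the rate D_k - D_l. Hence the rank-one
   part of the linearization is symmetric on this plane, where A_0 is a nonzero
   antisymmetric matrix. *)
Lemma linearization_not_symmetric (a : 'rV[R]_n) H1 (p q : 'rV[R[i]]_n) k l :
  a 0 k != a 0 l -> H1 \is hermsymmx ->
  diag_mx p \is hermsymmx -> diag_mx q \is hermsymmx ->
  let Df := linearization (bloch_mx xi (drift a)) (bloch_mx xi H1)
    (bloch xi (diag_mx q)) (bloch xi (diag_mx p)) in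
  Df^T <> Df.
Proof.
move=> akl hH1 hp hq Df DfT.
have kl : k != l by apply: contraNneq akl => ->.
set X := offdiag_re k l; set Y := offdiag_im k l.
have hX : X \is hermsymmx := offdiag_re_herm k l.
have hY : Y \is hermsymmx := offdiag_im_herm k l.
have DfXY := linearization_bloch (drift_herm a) hH1 hp hq hX hY.
have DfYX := linearization_bloch (drift_herm a) hH1 hp hq hY hX.
have sym : ((bloch xi X)^T *m Df *m bloch xi Y) 0 0 =
           ((bloch xi Y)^T *m Df *m bloch xi X) 0 0.
  have DfT_XY : ((bloch xi X)^T *m Df *m bloch xi Y)^T =
                (bloch xi Y)^T *m Df *m bloch xi X.
    by rewrite !trmx_mul trmxK DfT mulmxA.
  by apply: etrans (congr1 (fun M : 'M[R]_1 => M 0 0) DfT_XY); apply/esym; rewrite mxE.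
(* Cyclicity makes the diagonal matrix the acting one, so that the rotation formulas apply; [trp]
   below does the same for [p]. *)
have trq A : \tr (diag_mx q *m lie H1 A) = - \tr (H1 *m lie (diag_mx q) A).
  by rewrite (tr_mul_lieC (diag_mx q)) (lieC A) mulmxN raddfN.
have := etrans (esym DfXY) (etrans (congr1 (real_complex R) sym) DfYX).
(* Here [al], [d], [e] are the gaps between entries [k] and [l] of [a], [p], [q], and [h], [h'] are
   the traces of [H1] against [X], [Y]. Both rank-one products equal [d * e * h * h'], so symmetry
   leaves [2 al = - 2 al]. *)
have combine (t t' f f' g g' h h' al d e : R[i]) :
  t = al * 2 -> t' = - al * 2 -> f = - d * h' -> f' = d * h ->
  g = - (e * h) -> g' = - (- e * h') -> t + f * g = t' + f' * g' -> al = 0.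
  move=> -> -> -> -> -> -> eq_al.
  have -> : al = (al * 2 + - d * h' * - (e * h) -
                 (- al * 2 + d * h * - (- e * h'))) / 4.
    by field.
  by rewrite eq_al subrr mul0r.
have trp A : \tr (A *m lie H1 (diag_mx p)) = \tr (H1 *m lie (diag_mx p) A).
  exact: tr_mul_lieC.
move=> eqD.
have /subr0_eq/complexI/eqP : (a 0 k)%:C - (a 0 l)%:C = 0; last by rewrite (negPf akl).
apply: (combine _ _ _ _ _ _ (\tr (H1 *m X)) (\tr (H1 *m Y)) _
  (p 0 k - p 0 l) (q 0 k - q 0 l) _ _ _ _ _ _ eqD).
- apply: etrans (tr_mul_lie_diag_im X _ k l) _.
  by rewrite !mxE; congr (_ * _); exact: tr_offdiag_re_sqr.
- apply: etrans (tr_mul_lie_diag_re Y _ k l) _.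
  by rewrite !mxE opprB; congr (_ * _); exact: tr_offdiag_im_sqr.
- by apply: etrans (trp X) _; rewrite opprB; exact: tr_mul_lie_diag_re.
- by apply: etrans (trp Y) _; exact: tr_mul_lie_diag_im.
- by apply: etrans (trq Y) _; congr (- _); exact: tr_mul_lie_diag_im.
- apply: etrans (trq X) _; congr (- _); rewrite opprB.
  exact: tr_mul_lie_diag_re.
Qed.

End Nonsymmetry.

(** * Symmetry of the Jacobian of a differentiable gradient *)

Section Hessian.
Variables (R : realType) (N : nat).
Implicit Types (F : 'cV[R]_N -> R) (s : 'cV[R]_N) (J : 'M[R]_N).

Lemma coord_le_norm s i : `|s i 0| <= `|s|.
Proof.
rewrite [leRHS]/Num.Def.normr /= mx_normrE.
exact: (le_bigmax _ (fun ij : 'I_N * 'I_1 => `|s ij.1 ij.2|) (i, 0)).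
Qed.

Lemma mulmx_col_continuous m (A : 'M[R]_(m, N)) :
  continuous (mulmx A : 'cV[R]_N -> 'cV[R]_m).
Proof.
move=> s; apply: differentiable_continuous.
have -> : mulmx A = \sum_j (fun h : 'cV[R]_N => h j 0 *: col j A).
  apply/funext => h; rewrite fct_sumE; apply/matrixP => i j.
  rewrite ord1 !mxE summxE; apply: eq_bigr => k _.
  by rewrite !mxE mulrC.
apply: differentiable_sum => j; apply: differentiableZl.
exact: differentiable_coord.
Qed.

Lemma is_diff_near_bound (g : 'cV[R]_N -> 'cV[R]_N) s J :
  is_diff s g (mulmx J) -> forall e : R, 0 < e ->
  exists2 d, 0 < d &
    forall v, `|v| < d -> `|g (v + s) - g s - J *m v| <= e * `|v|.
Proof.
move=> [dg eqJ] e e0; have /diff_locally := dg; rewrite eqJ => /eqaddoP/(_ e e0).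
move=> /nbhs_ballP [d /= d0 dP]; exists d => // v vd.
have := dP v; rewrite -ball_normE /= sub0r normrN => /(_ vd).
by rewrite /= opprD addrA.
Qed.

(** Restricting [F] to a coordinate line makes the one-variable mean value theorem available. *)
Lemma is_derive_partial_line F s (i : 'I_N) (t : R) :
  (forall x, derivable F x (delta_mx i 0)) ->
  is_derive t 1 (fun x : R => F (x *: delta_mx i 0 + s))
    (partial i F (t *: delta_mx i 0 + s)).
Proof.
move=> dF; have := dF (t *: delta_mx i 0 + s); rewrite /partial.
have eq_quot : (fun h : R => h^-1 *: (((fun x : R => F (x *: delta_mx i 0 + s))
      \o shift t) (h *: 1) - F (t *: delta_mx i 0 + s))) =
    (fun h : R => h^-1 *: ((F \o shift (t *: delta_mx i 0 + s)) (h *: delta_mx i 0)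
      - F (t *: delta_mx i 0 + s))).
  by apply/funext => h; rewrite /= [h *: 1]mulr1 scalerDl addrA.
by move=> dFt; apply: DeriveDef; rewrite /derivable /derive eq_quot.
Qed.

(* Mean value theorem along e_i, then the differential of the i-th partial
   derivative at s. The second difference itself is symmetric in i and j. *)
Lemma second_difference_bound F s J (i j : 'I_N) :
  (forall k x, derivable F x (delta_mx k 0)) -> is_diff s (gradient F) (mulmx J) ->
  forall e : R, 0 < e -> exists2 d, 0 < d & forall h : R, 0 < h -> h < d ->
    `|F (h *: delta_mx i 0 + (h *: delta_mx j 0 + s)) - F (h *: delta_mx i 0 + s)
      - F (h *: delta_mx j 0 + s) + F s - h ^+ 2 * J i j| <= e * h ^+ 2.
Proof.
move=> dF dg e e0; set ei := delta_mx i 0; set ej := delta_mx j 0.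
(* All displacements used have norm at most [h * c]; the added 1 ensures [c > 0]. With tolerance
   [e / (2 * c)] each of the two remainders is at most [e * h / 2]. *)
pose c := `|ei| + `|ej| + 1.
have c0 : 0 < c by rewrite ltr_wpDl // addr_ge0.
have [d d0 dP] := is_diff_near_bound dg (divr_gt0 e0 (mulr_gt0 (ltr0n _ 2) c0)).
exists (d / c) => [|h h0 hd]; first by rewrite divr_gt0.
pose G (x : R) := F (x *: ei + (h *: ej + s)) - F (x *: ei + s).
pose G' (x : R) := partial i F (x *: ei + (h *: ej + s)) - partial i F (x *: ei + s).
have dG (x : R) : is_derive x 1 G (G' x).
  exact: is_deriveB (is_derive_partial_line _ _ (dF i))
                    (is_derive_partial_line _ _ (dF i)).
have [|x /[!in_itv] /= /andP[x0 xh] GE] := MVT h0 (fun x _ => dG x).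
  apply: derivable_within_continuous => x _; exact: ex_derive.
have -> : F (h *: ei + (h *: ej + s)) - F (h *: ei + s) - F (h *: ej + s) + F s
    = G h - G 0.
  by rewrite /G !scale0r !add0r; ring.
have rem v : `|v| <= h * c -> `|(gradient F (v + s) - gradient F s - J *m v) i 0|
    <= e / (2 * c) * (h * c).
  move=> vh; apply: le_trans (coord_le_norm _ _) _; apply: le_trans (dP _ _) _.
    by apply: le_lt_trans vh _; rewrite -ltr_pdivlMr.
  by rewrite ler_wpM2l // ltW // divr_gt0 // mulr_gt0.
have norm_x : `|x *: ei| <= h * `|ei|.
  by rewrite normrZ gtr0_norm // ler_wpM2r // ltW.
have r1 := rem (x *: ei + h *: ej) _; have r2 := rem (x *: ei) _.
rewrite GE subr0.
(* The linear parts of the two remainders differ by [h *: col j J], whose coordinate [i] is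
   [h * J i j]; the outer factor [h] comes from the mean value theorem. *)
have -> : G' x * h - h ^+ 2 * J i j =
    h * ((gradient F (x *: ei + h *: ej + s) - gradient F s
          - J *m (x *: ei + h *: ej)) i 0 -
         (gradient F (x *: ei + s) - gradient F s - J *m (x *: ei)) i 0).
  have -> : J *m (x *: ei + h *: ej) = J *m (x *: ei) + h *: col j J.
    by rewrite mulmxDr -[J *m (h *: ej)]scalemxAr -colE.
  by move: (J *m (x *: ei)) => w; rewrite /G' !mxE (addrA (x *: ei)); ring.
rewrite normrM gtr0_norm // expr2 mulrCA ler_pM2l //.
have -> : e * h = e / (2 * c) * (h * c) + e / (2 * c) * (h * c).
  by field; rewrite gt_eqF.
apply: le_trans (ler_normB _ _) _; apply: lerD.
  apply: r1; apply: le_trans (ler_normD _ _) _.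
  rewrite [`|h *: ej|]normrZ gtr0_norm // /c !mulrDr mulr1 -[leLHS]addr0.
  by rewrite lerD ?lerD2r // ltW.
apply: r2; apply: le_trans norm_x _.
by rewrite ler_pM2l // /c -addrA lerDl addr_ge0.
Qed.

(** The same second difference, divided by [h ^+ 2], is within [e / 2] of both [J i j] and [J j i]
    for small [h]. *)
Lemma hessian_symmetric F s J :
  (forall k x, derivable F x (delta_mx k 0)) -> is_diff s (gradient F) (mulmx J) ->
  J^T = J.
Proof.
move=> dF dg; apply/matrixP => i j; rewrite mxE; apply/eqP.
rewrite -subr_eq0 -normr_le0; apply/ler_addgt0Pr => e e0; rewrite add0r.
have e20 : 0 < e / 2 by rewrite divr_gt0.
have [d1 d10 d1P] := second_difference_bound i j dF dg e20.
have [d2 d20 d2P] := second_difference_bound j i dF dg e20.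
pose h := Num.min d1 d2 / 2.
have m0 : 0 < Num.min d1 d2 by rewrite lt_min d10.
have h0 : 0 < h by rewrite divr_gt0.
have hm : h < Num.min d1 d2 by rewrite ltr_pdivrMr // ltr_pMr // ltr1n.
have /andP[hd1 hd2] : (h < d1) && (h < d2) by rewrite -lt_min.
have h20 : 0 < h ^+ 2 by rewrite exprn_gt0.
have := ler_normB _ _.
move=> _; rewrite -(ler_pM2l h20) -{1}(gtr0_norm h20) -normrM.
(* Reordering the increments and the two middle terms makes both bounds speak of one quantity
   [D]. *)
move: (d1P h h0 hd1) (d2P h h0 hd2); rewrite (addrCA (h *: delta_mx j 0)).
rewrite [X in X + F s - _ * J j i]addrAC.
move: (_ - _ + _) => D.
rewrite !ler_norml => /andP[? ?] /andP[? ?]; apply/andP; split; lra.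
Qed.

End Hessian.

(** * Differential of the Bloch field at zeros of the feedback *)

Section Linearization.
Variables (R : realType) (N : nat).
Implicit Types (A : 'M[R]_N) (s sd : 'cV[R]_N).

Lemma feedback_continuous A sd : continuous (feedback A sd).
Proof.
move=> s; apply: (@continuous_comp _ _ _ (mulmx (sd^T *m A))
  (fun M : 'M[R]_(1, 1) => M 0 0)).
  exact: mulmx_col_continuous.
exact: coord_continuous.
Qed.

Lemma feedbackD A sd s t :
  feedback A sd (s + t) = feedback A sd s + feedback A sd t.
Proof. by rewrite /feedback mulmxDr mxE. Qed.

(** A product of two linear functions of [h]: the scalar one tends to 0, the other is Lipschitz. *)
Lemma feedback_mulmx_littleo A sd :
  (fun h => feedback A sd h *: (A *m h)) =o_ (0 : 'cV[R]_N) id.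
Proof.
have [k k0 kP] := linear_lipschitz (@mulmx_col_continuous _ _ _ A).
apply/eqoP => e e0; near=> h; rewrite normrZ.
have fh : `|feedback A sd h| <= e / k.
  near: h; apply: cvgr0_norm_le; last by rewrite divr_gt0.
  have := @feedback_continuous A sd 0.
  by rewrite /continuous_at /feedback mulmx0 mxE.
apply: le_trans (ler_pM _ _ fh (kP h)) _ => //.
by rewrite mulrA divfK ?gt_eqF.
Unshelve. all: by end_near. Qed.

(** As the feedback vanishes at [s], the increment is exactly the linear part plus the quadratic
    term [feedback A1 sd h *: (A1 *m h)]. *)
Lemma is_diff_bloch_field A0 A1 sd s : feedback A1 sd s = 0 ->
  is_diff s (bloch_field A0 A1 sd) (fun h => linearization A0 A1 sd s *m h).
Proof.
move=> fs0; set J := linearization A0 A1 sd s.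
have expansion : bloch_field A0 A1 sd \o shift s =
    cst (bloch_field A0 A1 sd s) + mulmx J +o_ (0 : 'cV[R]_N) id.
  apply/eqaddoE; rewrite funeqE => h /=.
  have -> : bloch_field A0 A1 sd (h + s) =
      (cst (bloch_field A0 A1 sd s) + mulmx J) h + feedback A1 sd h *: (A1 *m h).
    have -> : (cst (bloch_field A0 A1 sd s) + mulmx J) h =
        bloch_field A0 A1 sd s + J *m h by [].
    rewrite /bloch_field feedbackD fs0 addr0 scale0r addr0 /J /linearization.
    rewrite !mulmxDl !mulmxDr -!scalemxAl.
    have -> : A1 *m s *m sd^T *m A1 *m h = feedback A1 sd h *: (A1 *m s).
      rewrite -!mulmxA (mulmxA sd^T) (mulmxA A1) [sd^T *m A1 *m h]mx11_scalar.
      by rewrite mul_mx_scalar.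
    by rewrite (addrC (A0 *m h)) -!addrA; congr (_ + (_ + _)); exact: addrC.
  congr (_ + _).
  by rewrite -[LHS]/((fun h => feedback A1 sd h *: (A1 *m h)) h) feedback_mulmx_littleo.
have eqJ := diff_unique (@mulmx_col_continuous _ _ _ J) expansion.
apply: DiffDef => //; apply/diff_locallyP; rewrite eqJ; split => //.
exact: mulmx_col_continuous.
Qed.

End Linearization.

Theorem mainTheorem10 (R : realType) (n : nat) (hn : (2 <= n)%N)
    (a : 'rV[R]_n) (ha : forall k l : 'I_n, (k <= l)%N -> a 0 l <= a 0 k)
    (H1 : 'M[R[i]]_n) (hH1 : H1 \is hermsymmx) (hideal : ideal a H1)
    (xi : 'I_(n ^ 2) -> 'M[R[i]]_n) (hxi : bloch_basis xi)
    (rho_d : 'M[R[i]]_n) (hdens : density rho_d) (hgen : generic rho_d)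
    (hstat : mx_commutator (drift a) rho_d = 0) :
  let A0 := bloch_mx xi (drift a) in
  let A1 := bloch_mx xi H1 in
  let sd := bloch xi rho_d in
  let V := bloch_field A0 A1 sd in
  let S := isospectral_stationary xi rho_d V in
  let Df := linearization A0 A1 sd in
  [/\ injective (fun sigma : 'S_n => bloch xi (permuted_diag sigma rho_d)),
      forall s, S s <->
        exists sigma : 'S_n, s = bloch xi (permuted_diag sigma rho_d),
      forall s, S s ->
        is_diff s V (fun h => Df s *m h) /\ (Df s)^T <> Df s &
      ~ gradient_flow V].
Proof.
have n_gt0 : (0 < n)%N := ltnW hn.
have a_inj : injective (a 0) := ideal_inj hideal.
have hH0 : drift a \is hermsymmx := drift_herm a.
have [d rhoE] : exists d, rho_d = diag_mx d.
  by exists (\row_i rho_d i i); exact: commutator_drift_diag a_inj hstat.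
subst rho_d => A0 A1 sd V S Df.
have d_inj := generic_diag_inj hgen.
have herm_d : diag_mx d \is hermsymmx := hdens.1.1.
have permE sigma : permuted_diag sigma (diag_mx d) = diag_mx (\row_i d 0 (sigma i)).
  by congr diag_mx; apply/rowP => i; rewrite !mxE eqxx.
have dens_perm sigma := density_permuted sigma hdens.
have herm_perm sigma := (dens_perm sigma).1.1.
have stationaryP s : S s <->
    exists sigma : 'S_n, s = bloch xi (permuted_diag sigma (diag_mx d)).
  split=> [[[rho [dens_rho iso_rho ->]] V0]|[sigma ->]].
    have [comm0 _] := (bloch_field_eq0 hxi n_gt0 hH0 hH1 herm_d dens_rho.1.1 hstat).1 V0.
    have rho_diag := commutator_drift_diag a_inj comm0.
    have [|sigma e] := @isospectral_diag _ _ d (\row_i rho i i).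
      by rewrite -rho_diag.
    by exists sigma; rewrite permE -e -rho_diag.
  rewrite permE; split.
    exists (diag_mx (\row_i d 0 (sigma i))).
    by split; [exact: dens_perm | exact: isospectral_permuted |].
  apply: (bloch_field_eq0 hxi n_gt0 hH0 hH1 herm_d (herm_perm sigma) hstat).2.
  split; first by rewrite /mx_commutator diag_mxC subrr.
  (* The feedback at a diagonal state becomes a trace of [H1] against the bracket of two diagonal
     matrices, which is zero. *)
  rewrite (tr_mul_lieC (diag_mx d)) lie_commutator0 ?mulmx0 ?mxtrace0 //.
  by rewrite /mx_commutator diag_mxC subrr.
have feedback0 s : S s -> feedback A1 sd s = 0.
  move=> [[rho [[[herm_rho _] _] _ ->]] V0]; apply: complexI.
  apply: etrans (feedback_bloch hxi n_gt0 hH1 herm_d herm_rho) _.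
  exact: ((bloch_field_eq0 hxi n_gt0 hH0 hH1 herm_d herm_rho hstat).1 V0).2.
have not_sym s : S s -> (Df s)^T <> Df s.
  move=> /stationaryP [sigma ->]; rewrite permE.
  (* The bound [2 <= n] provides the two distinct levels 0 and 1. *)
  have ne01 : a 0 (Ordinal n_gt0) != a 0 (Ordinal hn).
    by apply/negP => /eqP/a_inj/(congr1 val).
  exact (linearization_not_symmetric hxi n_gt0 ne01 hH1 (herm_perm sigma) herm_d).
have diff_V s : S s -> is_diff s V (fun h => Df s *m h).
  by move=> /feedback0; exact: is_diff_bloch_field.
split.
- move=> sigma tau; rewrite !permE => eq_bloch.
  (* Both density operators have trace 1, so their Bloch vectors determine them; distinct diagonal
     entries then determine the permutation. *)
  have := bloch_inj hxi n_gt0 (herm_perm sigma) (herm_perm tau)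
    (etrans (dens_perm sigma).2 (esym (dens_perm tau).2)) eq_bloch.
  move=> /matrixP eq_diag; apply/permP => i; apply: d_inj.
  by have := eq_diag i i; rewrite !mxE eqxx.
- exact: stationaryP.
- by move=> s Ss; split; [exact: diff_V | exact: not_sym].
move=> [F [[C1F _] VF]].
(* One stationary point suffices for the contradiction; the identity permutation gives the target
   itself. *)
have S1 : S (bloch xi (permuted_diag 1%g (diag_mx d))).
  by apply/stationaryP; exists 1%g.
apply: (not_sym _ S1); apply: (@hessian_symmetric _ _ F).
  by move=> k x; exact: (C1F k).1.
have -> : gradient F = V by apply/funext => s; rewrite VF.
exact: diff_V.
Qed.
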